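(* Let $0<a<1$ and $b>0$, and let $0\le u<v\le s<t$. (a) Let $H\in(1/2,1)$ and let $\xi^H$ be oscillatory fractional Brownian motion with parameter $H$. There are positive finite constants $C^H_1(u,v,s,t)$, $C^H_2(u,v,s,t)$ such that $$0<C^H_1(u,v,s,t)\le\liminf_{\tau\to\infty}\tau^{2-2H}E(\xi^H_v-\xi^H_u)(\xi^H_{t+\tau}-\xi^H_{s+\tau})\le\limsup_{\tau\to\infty}\tau^{2-2H}E(\xi^H_v-\xi^H_u)(\xi^H_{t+\tau}-\xi^H_{s+\tau})\le C^H_2(u,v,s,t)<\infty.$$ (b) Let $H\in(1/2,1)\cup(1,3/2)$ and let $\zeta^H$ be oscillatory sub-fractional Brownian motion with parameter $H$ (if $H\in(1/2,1)$) or oscillatory negative sub-fractional Brownian motion with parameter $H$ (if $H\in(1,3/2)$). There are positive finite constants $C^H_3(u,v,s,t)$, $C^H_4(u,v,s,t)$ such that $$0<C^H_3(u,v,s,t)\le\liminf_{\tau\to\infty}\tau^{3-2H}E(\zeta^H_v-\zeta^H_u)(\zeta^H_{t+\tau}-\zeta^H_{s+\tau})\le\limsup_{\tau\to\infty}\tau^{3-2H}E(\zeta^H_v-\zeta^H_u)(\zeta^H_{t+\tau}-\zeta^H_{s+\tau})\le C^H_4(u,v,s,t)<\infty.$$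
   Context: Fix constants $0<a<1$ and $b>0$. For $H\in(1/2,1)$ let $h_t=\sum_{j\in\mathbb Z}(ba^jt)^{-2H}(e^{-ba^jt}-1+ba^jt)$, $t>0$, $h_0=0$. For $H\in(1,3/2)$ let $\widetilde h_t=\sum_{j\in\mathbb Z}(ba^jt)^{-2H}\left(e^{-ba^jt}-1+ba^jt-\frac12(ba^jt)^2\right)$, $t>0$, with the convention $0^{2H}\widetilde h_0=0$. - Oscillatory fractional Brownian motion, $H\in(1/2,1)$: centered Gaussian process $\xi^H$ with $E\xi^H_s\xi^H_t=\frac12\left(s^{2H}h_s+t^{2H}h_t-|s-t|^{2H}h_{|s-t|}\right)$, $s,t\ge0$. - Oscillatory sub-fractional Brownian motion, $H\in(1/2,1)$: centered Gaussian process $\zeta^H$ with $E\zeta^H_s\zeta^H_t=s^{2H}h_s+t^{2H}h_t-\frac12\left[(s+t)^{2H}h_{s+t}+|s-t|^{2H}h_{|s-t|}\right]$, $s,t\ge0$. - Oscillatory negative sub-fractional Brownian motion, $H\in(1,3/2)$: centered Gaussian process $\zeta^H$ with the same covariance formula as the previous one but with $h$ replaced by $\widetilde h$. *)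

(* Defs.v *)
From HB Require Import structures.
From mathcomp Require Import all_boot all_order all_algebra.
From mathcomp Require Import all_classical all_reals all_analysis.

Set Implicit Arguments.
Unset Strict Implicit.
Unset Printing Implicit Defensive.

Import Order.TTheory GRing.Theory Num.Theory.
Import numFieldNormedType.Exports.

Local Open Scope classical_set_scope.
Local Open Scope ring_scope.

(* Both one-sided series converge absolutely in the uses below, so the way the
   two-sided sum over the integers is taken is immaterial. *)
Definition sum_int (R : realType) (f : int -> R) : R :=
  limn (series (fun n : nat => f n%:Z)) +
  limn (series (fun n : nat => f (- n.+1%:Z))).

Definition osc_h (R : realType) (a b H t : R) : R :=
  if t == 0 then 0 else
  sum_int (fun j : int => let x := b * a ^ j * t in
    x `^ (- (2 * H)) * (expR (- x) - 1 + x)).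

(* The paper only fixes 0 ^ (2 H) * h 0 = 0, which any value at 0 satisfies. *)
Definition osc_h_tilde (R : realType) (a b H t : R) : R :=
  if t == 0 then 0 else
  sum_int (fun j : int => let x := b * a ^ j * t in
    x `^ (- (2 * H)) * (expR (- x) - 1 + x - x ^+ 2 / 2)).

(* [normal_prob m 0] is the uniform law on [0, 1] in the library, hence the
   separate degenerate case. *)
Definition gaussian_law (R : realType) (mu : set R -> \bar R) : Prop :=
  exists m sigma : R, 0 <= sigma /\
    forall A : set R, measurable A ->
      mu A = if sigma == 0 then \d_m A else normal_prob m sigma A.

(* Processes are indexed by all of R, but only the times t >= 0 are
   constrained or used. *)
Definition gaussian_process (R : realType) (d : measure_display)
    (T : measurableType d) (P : probability T R) (X : R -> {RV P >-> R}) : Prop :=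
  forall (n : nat) (time : 'I_n -> R) (c : 'I_n -> R),
    (forall i, 0 <= time i) ->
    gaussian_law (pushforward P (fun w : T => \sum_(i < n) c i * X (time i) w)).

Definition centered_gaussian_process (R : realType) (d : measure_display)
    (T : measurableType d) (P : probability T R) (X : R -> {RV P >-> R})
    (K : R -> R -> R) : Prop :=
  [/\ gaussian_process X,
      (forall t : R, 0 <= t -> ('E_P[X t] = 0)%E) &
      (forall s t : R, 0 <= s -> 0 <= t ->
        ('E_P[((X s : T -> R) * (X t : T -> R))%R] = (K s t)%:E)%E)].

Definition fbm_cov (R : realType) (h : R -> R) (H s t : R) : R :=
  (s `^ (2 * H) * h s + t `^ (2 * H) * h t
   - `|s - t| `^ (2 * H) * h `|s - t|) / 2.

Definition sub_fbm_cov (R : realType) (h : R -> R) (H s t : R) : R :=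
  s `^ (2 * H) * h s + t `^ (2 * H) * h t
  - ((s + t) `^ (2 * H) * h (s + t) + `|s - t| `^ (2 * H) * h `|s - t|) / 2.

Definition osc_fbm (R : realType) (a b H : R) (d : measure_display)
    (T : measurableType d) (P : probability T R) (X : R -> {RV P >-> R}) : Prop :=
  1 / 2 < H < 1 /\ centered_gaussian_process X (fbm_cov (osc_h a b H) H).

Definition osc_sub_fbm (R : realType) (a b H : R) (d : measure_display)
    (T : measurableType d) (P : probability T R) (X : R -> {RV P >-> R}) : Prop :=
  1 / 2 < H < 1 /\ centered_gaussian_process X (sub_fbm_cov (osc_h a b H) H).

Definition osc_neg_sub_fbm (R : realType) (a b H : R) (d : measure_display)
    (T : measurableType d) (P : probability T R) (X : R -> {RV P >-> R}) : Prop :=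
  1 < H < 3 / 2 /\
  centered_gaussian_process X (sub_fbm_cov (osc_h_tilde a b H) H).

Definition shifted_increment_cov (R : realType) (d : measure_display)
    (T : measurableType d) (P : probability T R) (X : R -> {RV P >-> R})
    (u v s t tau : R) : \bar R :=
  ('E_P[(((X v : T -> R) \- (X u : T -> R)) *
         ((X (t + tau) : T -> R) \- (X (s + tau) : T -> R)))%R])%E.

(* Main.v *)
(* With l_j = b a^j, expand the increment covariance under the two-sided sum:
   the polynomial parts of the kernels cancel and it becomes
     sum_j l_j^(-2H) exp(-l_j tau) W(l_j),
   where W(x) is (exp(-xs) - exp(-xt)) (exp(xv) - exp(xu)) / 2 in case (a), and
   that times 1 - exp(-x(u+v)) in case (b).  By the mean value theorem,
     M x^k exp(-T x) <= W(x) <= M x^k   with k = 2, resp. 3.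
   After multiplication by tau^p, p = k - 2H in (0, 2), the sum compares with
   sum_j (l_j tau)^p exp(-l_j tau).  It is bounded below by the single term
   with 1 <= l_j tau <= 1/a.  For the upper bound, y^p exp(-y) is at most a
   constant times G(y) - G(a y), G(y) = y^p / (1 + y^p), and since 0 <= G <= 1
   the sum of these differences over all j telescopes to at most 1. *)
Require Import Defs.
From HB Require Import structures.
From mathcomp Require Import all_boot all_order all_algebra.
From mathcomp Require Import all_classical all_reals all_analysis.
From mathcomp Require Import measurable_realfun ring lra.

Set Implicit Arguments.
Unset Strict Implicit.
Unset Printing Implicit Defensive.

Import Order.TTheory GRing.Theory Num.Theory.
Import numFieldNormedType.Exports.

Local Open Scope classical_set_scope.
Local Open Scope ring_scope.

(** A relation rather than a value: it records that both halves converge, which the total function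
    [sum_int], built on [limn], does not. *)
Definition has_sum_int (R : realType) (f : int -> R) (l : R) : Prop :=
  exists l1 l2 : R, [/\ series (fun n : nat => f n%:Z) @ \oo --> l1,
    series (fun n : nat => f (- n.+1%:Z)) @ \oo --> l2 & l = l1 + l2].

(** * Calculus of two-sided series *)

Section SumInt.
Variable R : realType.
Implicit Types (f g : int -> R) (l m : R).

Lemma has_sum_intE f l : has_sum_int f l -> sum_int f = l.
Proof.
move=> [l1 [l2 [h1 h2 ->]]].
by rewrite /sum_int (cvg_lim _ h1)// (cvg_lim _ h2).
Qed.

Lemma has_sum_intD f g l m : has_sum_int f l -> has_sum_int g m ->
  has_sum_int (fun j => f j + g j) (l + m).
Proof.
move=> [l1 [l2 [hl1 hl2 ->]]] [m1 [m2 [hm1 hm2 ->]]].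
exists (l1 + m1), (l2 + m2); split; last by rewrite addrACA.
- have -> : series (fun n : nat => f n%:Z + g n%:Z) =
    series (fun n : nat => f n%:Z) + series (fun n : nat => g n%:Z).
    by rewrite -seriesD.
  exact: cvgD.
- have -> : series (fun n : nat => f (- n.+1%:Z) + g (- n.+1%:Z)) =
    series (fun n : nat => f (- n.+1%:Z)) +
    series (fun n : nat => g (- n.+1%:Z)).
    by rewrite -seriesD.
  exact: cvgD.
Qed.

Lemma has_sum_intZ (c : R) f l : has_sum_int f l ->
  has_sum_int (fun j => c * f j) (c * l).
Proof.
move=> [l1 [l2 [h1 h2 ->]]]; exists (c * l1), (c * l2); split.
- have -> : series (fun n : nat => c * f n%:Z) =
    c *: series (fun n : nat => f n%:Z).
    by apply/funext => n; rewrite /series /= -mulr_sumr.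
  exact: cvgZr.
- have -> : series (fun n : nat => c * f (- n.+1%:Z)) =
    c *: series (fun n : nat => f (- n.+1%:Z)).
    by apply/funext => n; rewrite /series /= -mulr_sumr.
  exact: cvgZr.
- by rewrite mulrDr.
Qed.

Lemma has_sum_intB f g l m : has_sum_int f l -> has_sum_int g m ->
  has_sum_int (fun j => f j - g j) (l - m).
Proof.
move=> fl gm; rewrite -mulN1r.
have := has_sum_intD fl (has_sum_intZ (- 1) gm).
by under [X in has_sum_int X]eq_fun do rewrite mulN1r.
Qed.

(** Partial sums of the two halves telescope to [C * (G 0 - G n)] and [C * (G (- n) - G 0)]. As G
    lies in [0, 1], the halves are at most [C * G 0] and [C * (1 - G 0)], which add up to C. *)
Lemma has_sum_int_le_telescope (C : R) f (G : int -> R) l : 0 <= C ->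
  (forall j, 0 <= G j <= 1) ->
  (forall j, f j <= C * (G j - G (j + 1))) -> has_sum_int f l -> l <= C.
Proof.
move=> C0 G01 fG [l1 [l2 [h1 h2 ->]]].
have -> : C = C * G 0 + C * (1 - G 0) by ring.
have P1 n : series (fun n => f n%:Z) n <= C * (G 0 - G n%:Z).
  elim: n => [|n IH]; first by rewrite /series /= big_geq// subrr mulr0.
  rewrite -[_ n.+1](subrK (series (fun n => f n%:Z) n)) seriesSB.
  have := fG n%:Z; rewrite (_ : n%:Z + 1 = n.+1%:Z) ?intS 1?addrC//.
  by move=> h; lra.
have P2 n : series (fun n => f (- n.+1%:Z)) n <= C * (G (- n%:Z) - G 0).
  elim: n => [|n IH]; first by rewrite /series /= big_geq// oppr0 subrr mulr0.
  rewrite -[_ n.+1](subrK (series (fun n => f (- n.+1%:Z)) n)) seriesSB.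
  have := fG (- n.+1%:Z); rewrite (_ : - n.+1%:Z + 1 = - n%:Z); last first.
    by rewrite intS opprD addrAC addNr add0r.
  by move=> h; lra.
apply: lerD.
- rewrite -(cvg_lim _ h1)//; apply: limr_le; first exact: cvgP h1.
  apply: nearW => n; apply: le_trans (P1 n) _.
  by apply: ler_wpM2l => //; have /andP[] := G01 n; lra.
- rewrite -(cvg_lim _ h2)//; apply: limr_le; first exact: cvgP h2.
  apply: nearW => n; apply: le_trans (P2 n) _.
  by apply: ler_wpM2l => //; have /andP[] := G01 (- n%:Z); lra.
Qed.

(** Used for the lower bound, where the selected term has a nonnegative index. The negative half is
    at least its empty partial sum 0. *)
Lemma has_sum_int_ge f l (n : nat) : (forall j, 0 <= f j) ->
  has_sum_int f l -> f n%:Z <= l.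
Proof.
move=> f0 [l1 [l2 [h1 h2 ->]]].
have nd (g : nat -> R) : (forall k, 0 <= g k) -> nondecreasing_seq (series g).
  by move=> g0; apply: nondecreasing_series => k _ _.
rewrite -[leLHS]addr0 lerD//.
- rewrite -(cvg_lim _ h1)//.
  have /(_ n.+1) := nondecreasing_cvgn_le (nd _ (fun k => f0 k%:Z)) (cvgP _ h1).
  move=> h; refine (le_trans _ h).
  rewrite -[leRHS](subrK (series (fun n => f n%:Z) n)) seriesSB.
  by rewrite lerDl /series /= sumr_ge0.
- rewrite -(cvg_lim _ h2)//.
  have /(_ 0%N) :=
    nondecreasing_cvgn_le (nd _ (fun k => f0 (- k.+1%:Z))) (cvgP _ h2).
  by rewrite {1}/series /= big_geq.
Qed.

Lemma le_geometric_is_cvg_series (u : nat -> R) (C q : R) : 0 <= q < 1 ->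
  (forall n, `|u n| <= C * q ^+ n) -> cvgn (series u).
Proof.
move=> /andP[q0 q1] uC; apply: normed_cvg.
apply: (@series_le_cvg _ _ (geometric C q)) => [n /=|||] //.
- by move=> n /=; exact: le_trans (normr_ge0 _) (uC n).
- by apply: is_cvg_geometric_series; rewrite ger0_norm.
Qed.

End SumInt.

(** * Real powers *)

Section PowR.
Variable R : realType.

Lemma powR_lt1 (x r : R) : 0 <= x < 1 -> 0 < r -> x `^ r < 1.
Proof.
move=> /andP[x0 x1] r0; rewrite -[ltRHS](congr1 (fun f => f r) (powR1 R)).
by rewrite gt0_ltr_powR// nnegrE.
Qed.

Lemma powR_exprn (x r : R) n : 0 <= x -> (x ^+ n) `^ r = (x `^ r) ^+ n.
Proof. by move=> x0; rewrite -!powR_mulrn ?powR_ge0// powRAC. Qed.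

Lemma powR_expM (x r : R) n : 0 < x -> x `^ (- r) * x ^+ n = x `^ (n%:R - r).
Proof.
move=> x0; rewrite -powR_mulrn ?ltW// -powRD; first by rewrite addrC.
by rewrite (gt_eqF x0) implybT.
Qed.

End PowR.

(** * Convergence of the defining series *)

Section ScaledKernel.
Variables (R : realType) (a b : R).
Hypotheses (a_gt0 : 0 < a) (a_lt1 : a < 1) (b_gt0 : 0 < b).

(** Each end has its own geometric majorant: the bound x^(q+1) gives ratio a^(q+1-r) as j tends to
    +oo, the bound x^q gives ratio a^(r-q) as j tends to -oo. Both ratios are below 1 because q < r
    < q+1. *)
Lemma is_cvg_scaled_kernel (phi : R -> R) (q : nat) (r t : R) :
  (forall x, 0 <= x -> `|phi x| <= x ^+ q) ->
  (forall x, 0 <= x -> `|phi x| <= x ^+ q.+1) ->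
  q%:R < r < q.+1%:R -> 0 < t ->
  exists l, has_sum_int
    (fun j : int => (b * a ^ j * t) `^ (- r) * phi (b * a ^ j * t)) l.
Proof.
move=> phi1 phi2 /andP[qr rq] t0.
have low (x : R) (k : nat) : 0 < x -> `|phi x| <= x ^+ k ->
    `|x `^ (- r) * phi x| <= x `^ (k%:R - r).
  move=> x0 h; rewrite normrM (ger0_norm (powR_ge0 _ _)) -powR_expM//.
  by rewrite ler_wpM2l ?powR_ge0.
have bt0 : 0 <= b * t by rewrite mulr_ge0 ?ltW.
have a0 : 0 <= a by exact: ltW.
have aV0 : 0 <= a^-1 by rewrite invr_ge0.
have xp j : 0 < b * a ^ j * t by rewrite !mulr_gt0// exprz_gt0.
have /cvg_ex[/= l1 h1] : cvgn (series (fun n : nat =>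
    (b * a ^ n%:Z * t) `^ (- r) * phi (b * a ^ n%:Z * t))).
  apply: (@le_geometric_is_cvg_series _ _ ((b * t) `^ (q.+1%:R - r))
    (a `^ (q.+1%:R - r))).
    by rewrite powR_ge0 powR_lt1 ?a_lt1 ?ltW// subr_gt0.
  move=> n; apply: le_trans (low _ q.+1 (xp _) (phi2 _ (ltW (xp _)))) _.
  by rewrite -powR_exprn// -powRM ?exprn_ge0// -exprnP mulrAC.
have /cvg_ex[/= l2 h2] : cvgn (series (fun n : nat =>
    (b * a ^ (- n.+1%:Z) * t) `^ (- r) * phi (b * a ^ (- n.+1%:Z) * t))).
  (* The negative half starts at index -1, whence the extra 1/a in the constant. *)
  apply: (@le_geometric_is_cvg_series _ _ ((b * t / a) `^ (q%:R - r))
    (a^-1 `^ (q%:R - r))).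
    rewrite powR_ge0 /= -powR_inv1// -powRrM mulN1r opprB.
    by rewrite powR_lt1 ?a_lt1 ?ltW// subr_gt0.
  move=> n; apply: le_trans (low _ q (xp _) (phi1 _ (ltW (xp _)))) _.
  rewrite -powR_exprn// -powRM ?exprn_ge0 ?divr_ge0//.
  rewrite -[b * t / a * _]mulrA -exprS exprVn exprnN.
  by rewrite mulrAC.
by exists (l1 + l2), l1, l2.
Qed.

End ScaledKernel.

(** * Estimates for weighted exponential sums *)

Section Bounds.
Variables (R : realType) (a b : R).
Hypotheses (a_gt0 : 0 < a) (a_lt1 : a < 1) (b_gt0 : 0 < b).

(** Absorbing t^r into the terms leaves a weight free of t, so that series at different times can be
    combined termwise. At t = 0 both sides vanish, by [phi 0 = 0]. *)
Lemma has_sum_int_scaled_kernel (phi : R -> R) (q : nat) (r t : R) :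
  (forall x, 0 <= x -> `|phi x| <= x ^+ q) ->
  (forall x, 0 <= x -> `|phi x| <= x ^+ q.+1) ->
  phi 0 = 0 -> q%:R < r < q.+1%:R -> 0 <= t ->
  has_sum_int (fun j : int => (b * a ^ j) `^ (- r) * phi (b * a ^ j * t))
    (t `^ r * (if t == 0 then 0 else
      sum_int (fun j : int => let x := b * a ^ j * t in x `^ (- r) * phi x))).
Proof.
move=> phi1 phi2 phi0 qr; rewrite le_eqVlt => /predU1P[<-|t0].
  rewrite eqxx mulr0; under eq_fun do rewrite mulr0 phi0 mulr0.
  have s0 : series (fun n : nat => 0 : R) = cst 0.
    by apply/funext => n; rewrite /series /= big1.
  by exists 0, 0; rewrite s0 addr0; split => //; exact: cvg_cst.
rewrite (gt_eqF t0).
have [l hl] := is_cvg_scaled_kernel a_gt0 a_lt1 b_gt0 phi1 phi2 qr t0.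
rewrite (has_sum_intE hl); have := has_sum_intZ (t `^ r) hl.
congr has_sum_int; apply/funext => j; rewrite mulrA; congr (_ * _).
have x0 : 0 <= b * a ^ j by rewrite mulr_ge0 ?exprz_ge0 ?ltW.
rewrite powRM ?(ltW t0)// mulrCA -powRD ?subrr ?powRr0 ?mulr1//.
by rewrite (gt_eqF t0) implybT.
Qed.

(** Take n+1 least with y a^(n+1) < 1; it is not 0 since y >= 1. Minimality gives the lower bound,
    division by a the upper one. *)
Lemma geometric_hit (y : R) : 1 <= y -> exists n, 1 <= y * a ^+ n <= a^-1.
Proof.
move=> y1; have [m m1] : exists m, y * a ^+ m < 1.
  have : geometric y a @ \oo --> 0.
    by apply: cvg_geometric; rewrite ger0_norm ?ltW.
  by move=> /cvgr_lt /(_ _ ltr01) /filter_ex[m]; exists m.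
have ex : exists m, y * a ^+ m < 1 by exists m.
case: (ex_minnP ex) => [[|n]] hn nmin.
  by move: hn; rewrite expr0 mulr1 ltNge y1.
exists n; apply/andP; split.
  by rewrite leNgt; apply/negP => /nmin; rewrite ltnn.
by rewrite -(ler_pM2r a_gt0) mulVf ?gt_eqF// -mulrA -exprSr ltW.
Qed.

(** As 0 < p < 2, y^p <= 1 + y^2. Hence 1 + y^p <= 8 (1 + y^2 / 8) <= 8 exp(y/2), and squaring gives
    64. *)
Lemma sqr_powR_le_expR (y p : R) : 0 <= y -> 0 < p < 2 ->
  (1 + y `^ p) ^+ 2 <= 64 * expR y.
Proof.
move=> y0 /andP[p0 p2].
have h1 : y `^ p <= 1 + y ^+ 2.
  have [y1|y1] := leP y 1.
    apply: (@le_trans _ _ 1); last by rewrite lerDl sqr_ge0.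
    rewrite -[leRHS](congr1 (fun f => f p) (powR1 R)).
    by rewrite ge0_ler_powR ?nnegrE// ltW.
  apply: (@le_trans _ _ (y ^+ 2)); last by rewrite lerDr.
  by rewrite -powR_mulrn// ler_powR ?ltW.
have h2 := @expR_ge1Dxn R (y / 2) 1 (divr_ge0 y0 (ler0n _ 2)).
have -> : expR y = expR (y / 2) ^+ 2 by rewrite -expRM_natl; congr expR; field.
have -> : (64 : R) = 8 ^+ 2 by ring.
rewrite -exprMn ler_sqr ?nnegrE ?mulr_ge0 ?expR_ge0 ?addr_ge0 ?powR_ge0//.
move: h2; rewrite (_ : 2`! = 2)%N// exprMn => h2.
have := sqr_ge0 y; lra.
Qed.

(** With z = y^p and c = a^p < 1, the difference of G is z (1 - c) / ((1 + z) (1 + z c)), at least z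
    (1 - c) / (1 + z)^2. The preceding bound on (1 + z)^2 then brings in exp(-y). *)
Lemma weighted_exp_le_telescope (y p : R) : 0 <= y -> 0 < p < 2 ->
  let G z := z `^ p / (1 + z `^ p) in
  y `^ p * expR (- y) <= 64 / (1 - a `^ p) * (G y - G (y * a)).
Proof.
move=> y0 p02 /=; have /andP[p0 p2] := p02.
have a0 := ltW a_gt0; rewrite powRM//.
have c1 : a `^ p < 1 by rewrite powR_lt1// a0.
have c0 : 0 <= a `^ p := powR_ge0 _ _.
have z0 : 0 <= y `^ p := powR_ge0 _ _.
have := sqr_powR_le_expR y0 p02; rewrite expRN.
have := expR_gt0 y.
move: (expR y) (y `^ p) (a `^ p) c1 c0 z0 => e z c c1 c0 z0 e0 h.
have zc : 0 <= z * c by rewrite mulr_ge0.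
have -> : 64 / (1 - c) * (z / (1 + z) - z * c / (1 + z * c)) =
   z * (64 / ((1 + z) * (1 + z * c))) by field; lra.
apply: ler_wpM2l => //; rewrite ler_pdivlMr ?mulr_gt0; try lra.
rewrite mulrC ler_pdivrMr//; apply: le_trans h.
rewrite expr2 ler_wpM2l ?addr_ge0// lerD2l ler_piMr//; exact: ltW.
Qed.

(** For l = b a^j and p = k - r, the factor tau^p turns l^(-r) l^k into (l tau)^p. The condition
    [b^-1 <= tau] lets some j >= 0 satisfy 1 <= l tau <= 1/a, and [T / a <= tau] then keeps l T at
    most 1. *)
Lemma has_sum_int_laplace_bounds (r : R) (k : nat) (W : R -> R)
    (M T tau S : R) : 0 < k%:R - r < 2 -> 0 <= T -> 0 <= M ->
  (forall x, 0 < x -> M * x ^+ k * expR (- (x * T)) <= W x <= M * x ^+ k) ->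
  b^-1 <= tau -> T / a <= tau ->
  has_sum_int (fun j : int => (b * a ^ j) `^ (- r) *
    (expR (- (b * a ^ j * tau)) * W (b * a ^ j))) S ->
  M * expR (- (a^-1 + 1)) <= tau `^ (k%:R - r) * S
    <= M * (64 / (1 - a `^ (k%:R - r))).
Proof.
move=> p02; have /andP[p0 p2] := p02.
set p := k%:R - r in p02 p0 p2 * => T0 M0 WM btau Ttau hS.
have tau0 : 0 < tau by apply: lt_le_trans btau; rewrite invr_gt0.
have l0 j : 0 < b * a ^ j by rewrite mulr_gt0// exprz_gt0.
have {hS} := has_sum_intZ (tau `^ p) hS.
have scale j : tau `^ p * ((b * a ^ j) `^ (- r) * (b * a ^ j) ^+ k) =
    (b * a ^ j * tau) `^ p.
  by rewrite powR_expM ?l0// -/p mulrC -powRM// ltW.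
have W0 x : 0 < x -> 0 <= W x.
  move=> x0; have /andP[h _] := WM x x0; apply: le_trans h.
  by rewrite !mulr_ge0 ?exprn_ge0 ?expR_ge0// ltW.
move=> hS; apply/andP; split.
- have [|n /andP[n1 n2]] := @geometric_hit (b * tau).
    by rewrite -ler_pdivrMl// mulr1.
  apply: le_trans (has_sum_int_ge n _ hS); last first.
    by move=> j; rewrite !mulr_ge0 ?powR_ge0 ?expR_ge0 ?W0.
  rewrite mulrAC exprnP in n1 n2.
  have /andP[h _] := WM _ (l0 n%:Z).
  set x := b * a ^ n%:Z in n1 n2 h *.
  apply: (@le_trans _ _ (tau `^ p * (x `^ (- r) * (expR (- (x * tau)) *
     (M * x ^+ k * expR (- (x * T))))))); last first.
    by rewrite !ler_wpM2l ?powR_ge0 ?expR_ge0.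
  have -> : tau `^ p * (x `^ (- r) * (expR (- (x * tau)) *
     (M * x ^+ k * expR (- (x * T))))) =
     M * ((x * tau) `^ p * expR (- (x * tau) - x * T)).
    by rewrite -scale expRD; ring.
  apply: ler_wpM2l => //; rewrite -[leLHS]mul1r ler_pM ?expR_ge0//.
    rewrite -[leLHS](congr1 (fun f => f p) (powR1 R)).
    by rewrite ge0_ler_powR ?nnegrE ?(ltW p0)// (le_trans _ n1).
  (* The summand [a^-1] bounds x tau; the summand 1 bounds x T, through x T <= x tau a <= 1. *)
  rewrite ler_expR opprD lerD// lerN2//.
  apply: (@le_trans _ _ (x * (tau * a))).
    by rewrite ler_wpM2l ?(ltW (l0 _))// -ler_pdivrMr.
  by rewrite mulrA -ler_pdivlMr// mul1r.
- have c1 : a `^ p < 1 by rewrite powR_lt1// ltW.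
  (* Passing from j to j + 1 multiplies the argument by a, so the differences of this G are those of
     [weighted_exp_le_telescope]. *)
  pose G (j : int) := (b * a ^ j * tau) `^ p / (1 + (b * a ^ j * tau) `^ p).
  apply: (@has_sum_int_le_telescope _ _ _ G _ _ _ _ hS).
  + by rewrite mulr_ge0// divr_ge0// subr_ge0 ltW.
  + move=> j; rewrite /G.
    have := powR_ge0 (b * a ^ j * tau) p; move: (_ `^ p) => z z0.
    by rewrite divr_ge0 ?addr_ge0//= ler_pdivrMr; lra.
  + move=> j; have /andP[_ h] := WM _ (l0 j).
    have -> : G (j + 1) = (b * a ^ j * tau * a) `^ p /
        (1 + (b * a ^ j * tau * a) `^ p).
      by rewrite /G exprzDr ?unitfE ?gt_eqF// expr1z; congr (_ / (1 + _));
        congr (_ `^ _); ring.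
    have y0 : 0 <= b * a ^ j * tau by rewrite mulr_ge0 ?ltW.
    have /(ler_wpM2l M0) := weighted_exp_le_telescope y0 p02.
    rewrite [in leRHS]mulrA; apply: le_trans; rewrite -scale.
    set x := b * a ^ j in h *.
    apply: (@le_trans _ _ (tau `^ p * (x `^ (- r) * (expR (- (x * tau)) *
     (M * x ^+ k))))); first by rewrite !ler_wpM2l ?powR_ge0 ?expR_ge0.
    by rewrite le_eqVlt; apply/predU1P; left; ring.
Qed.

End Bounds.

(** * Taylor remainders of the exponential *)

Section ExpRemainders.
Variable R : realType.
Implicit Types x y : R.

Lemma ge0_of_derive_ge0 (f df : R -> R) :
  (forall x, is_derive x 1 f (df x)) -> f 0 = 0 ->
  (forall x, 0 <= x -> 0 <= df x) -> forall x, 0 <= x -> 0 <= f x.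
Proof.
move=> fdf f0 df0 x x0.
suff : (\- f) x <= (\- f) 0 by rewrite /= f0 lerN2.
have dNf y : is_derive y 1 (\- f) (- df y) by exact: is_deriveN.
apply: (@ler0_derive1_nincry _ (\- f) 0) => //.
- move=> y; rewrite in_itv /= andbT => y0.
  by rewrite derive1E derive_val oppr_le0 df0// ltW.
- apply: continuous_subspaceT => y; apply: differentiable_continuous.
  by apply/derivable1_diffP; exact: ex_derive.
Qed.

(** Both bounds rest on exp(-x) >= 1 - x: the upper one because the derivative of its defect is
    exp(-x) - 1 + x again. *)
Lemma expRN_taylor1_bounds x : 0 <= x ->
  0 <= expR (- x) - 1 + x /\ expR (- x) - 1 + x <= x ^+ 2 / 2.
Proof.
move=> x0; split; first by have := expR_ge1Dx (- x); lra.
rewrite -subr_ge0.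
apply: (@ge0_of_derive_ge0 (fun z => z ^+ 2 / 2 - (expR (- z) - 1 + z))
  (fun z => z + expR (- z) - 1) _ _ _ x x0) => [z||z _].
- by apply: is_derive_eq; rewrite /GRing.scale /=; field.
- by rewrite oppr0 expR0; ring.
- by have := expR_ge1Dx (- z); lra.
Qed.

(** One order further: the defect of the lower bound has as derivative the defect of the upper bound
    in [expRN_taylor1_bounds]. *)
Lemma expRN_taylor2_bounds x : 0 <= x ->
  - (x ^+ 3 / 6) <= expR (- x) - 1 + x - x ^+ 2 / 2 /\
  expR (- x) - 1 + x - x ^+ 2 / 2 <= 0.
Proof.
move=> x0; split; last by have [_] := expRN_taylor1_bounds x0; lra.
rewrite -subr_ge0 opprK addrC.
apply: (@ge0_of_derive_ge0
  (fun z => z ^+ 3 / 6 + (expR (- z) - 1 + z - z ^+ 2 / 2))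
  (fun z => z ^+ 2 / 2 - (expR (- z) - 1 + z)) _ _ _ x x0) => [z||z z0].
- by apply: is_derive_eq; rewrite /GRing.scale /=; field.
- by rewrite oppr0 expR0; ring.
- by have [_] := expRN_taylor1_bounds z0; lra.
Qed.

(** Replaces the mean value theorem: multiply exp(z - w) >= 1 + z - w by exp(w), then exchange the
    roles of x and y. *)
Lemma expRB_bounds x y :
  (x - y) * expR y <= expR x - expR y <= (x - y) * expR x.
Proof.
have h (z w : R) : (z - w) * expR w <= expR z - expR w.
  rewrite -{2}[z](subrK w) expRD -{3}[expR w]mul1r -mulrBl.
  by rewrite ler_wpM2r ?expR_ge0//; have := expR_ge1Dx (z - w); lra.
by rewrite h /=; have := h y x; lra.
Qed.

End ExpRemainders.

(** * Increment covariances as two-sided sums *)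

Section Covariances.
Variables (R : realType) (a b : R).
Hypotheses (a_gt0 : 0 < a) (a_lt1 : a < 1) (b_gt0 : 0 < b).

Lemma has_sum_int_osc_h (H t : R) : 1 / 2 < H < 1 -> 0 <= t ->
  has_sum_int (fun j : int => (b * a ^ j) `^ (- (2 * H)) *
     (expR (- (b * a ^ j * t)) - 1 + b * a ^ j * t))
    (t `^ (2 * H) * osc_h a b H t).
Proof.
move=> H01 t0.
apply: (has_sum_int_scaled_kernel (phi := fun x => expR (- x) - 1 + x)
  (q := 1) a_gt0 a_lt1 b_gt0) => //.
- move=> x x0; have [h _] := expRN_taylor1_bounds x0; rewrite ger0_norm//.
  have : expR (- x) <= 1 by rewrite expR_le1 oppr_le0.
  by rewrite expr1; lra.
- move=> x x0; have [h ?] := expRN_taylor1_bounds x0; rewrite ger0_norm//.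
  by have := sqr_ge0 x; lra.
- by rewrite oppr0 expR0; ring.
- lra.
Qed.

(** Subtracting the quadratic term raises the order at 0 by one: the kernel is bounded by x^2 and by
    x^3, which suits 2 < 2H < 3. *)
Lemma has_sum_int_osc_h_tilde (H t : R) : 1 < H < 3 / 2 -> 0 <= t ->
  has_sum_int (fun j : int => (b * a ^ j) `^ (- (2 * H)) *
     (expR (- (b * a ^ j * t)) - 1 + b * a ^ j * t - (b * a ^ j * t) ^+ 2 / 2))
    (t `^ (2 * H) * osc_h_tilde a b H t).
Proof.
move=> H01 t0.
apply: (has_sum_int_scaled_kernel
  (phi := fun x => expR (- x) - 1 + x - x ^+ 2 / 2)
  (q := 2) a_gt0 a_lt1 b_gt0) => //.
- move=> x x0; have [h1 _] := expRN_taylor1_bounds x0.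
  have [_ h2] := expRN_taylor2_bounds x0; rewrite ler0_norm//.
  by have := sqr_ge0 x; lra.
- move=> x x0; have [h1 h2] := expRN_taylor2_bounds x0; rewrite ler0_norm//.
  by have := exprn_ge0 3 x0; lra.
- by rewrite oppr0 expR0; ring.
- lra.
Qed.

(** If K is the covariance of a centered X, this is the covariance of X_v - X_u and X_t - X_s. *)
Definition rect_incr (K : R -> R -> R) (u v s t : R) : R :=
  K v t - K v s - (K u t - K u s).

Lemma fbm_rect_incrE (h : R -> R) (H u v s t : R) :
  u <= v -> v <= s -> s <= t ->
  let g x := x `^ (2 * H) * h x in
  rect_incr (fbm_cov h H) u v s t =
  2^-1 * (g (s - v) - g (t - v) + (g (t - u) - g (s - u))).
Proof.
move=> uv vs st g; rewrite /rect_incr /fbm_cov.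
by rewrite (distrC v t) (distrC v s) (distrC u t) (distrC u s) !ger0_norm /g;
  [field|lra..].
Qed.

Lemma sub_fbm_rect_incrE (h : R -> R) (H u v s t : R) :
  u <= v -> v <= s -> s <= t ->
  let g x := x `^ (2 * H) * h x in
  rect_incr (sub_fbm_cov h H) u v s t =
  2^-1 * (g (s - v) - g (t - v) + (g (t - u) - g (s - u))
          + (g (v + s) - g (v + t) + (g (u + t) - g (u + s)))).
Proof.
move=> uv vs st g; rewrite /rect_incr /sub_fbm_cov.
by rewrite (distrC v t) (distrC v s) (distrC u t) (distrC u s) !ger0_norm /g;
  [field|lra..].
Qed.

Definition fbm_weight (u v s t x : R) : R :=
  2^-1 * ((expR (- (x * s)) - expR (- (x * t))) *
          (expR (x * v) - expR (x * u))).

Definition sub_fbm_weight (u v s t x : R) : R :=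
  fbm_weight u v s t x * (1 - expR (- (x * (u + v)))).

(** The four kernels enter with signs +, -, +, -, and their times have signed sum 0, so constant and
    linear parts cancel. The remaining exponentials factor. *)
Lemma has_sum_int_fbm (H u v s t tau : R) : 1 / 2 < H < 1 ->
  u <= v -> v <= s -> s <= t -> 0 <= tau ->
  has_sum_int (fun j : int => (b * a ^ j) `^ (- (2 * H)) *
    (expR (- (b * a ^ j * tau)) * fbm_weight u v s t (b * a ^ j)))
    (rect_incr (fbm_cov (osc_h a b H) H) u v (s + tau) (t + tau)).
Proof.
move=> H01 uv vs st tau0; rewrite fbm_rect_incrE; [|lra..].
have S x : 0 <= x -> _ := @has_sum_int_osc_h H x H01.
have := has_sum_intZ 2^-1 (has_sum_intD
  (has_sum_intB (S (s + tau - v) _) (S (t + tau - v) _))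
  (has_sum_intB (S (t + tau - u) _) (S (s + tau - u) _))).
move=> /(_ ltac:(lra) ltac:(lra) ltac:(lra) ltac:(lra)).
congr has_sum_int; apply/funext => j; set x := b * a ^ j.
have expE y z : expR (- (x * (y + tau - z))) =
    expR (- (x * tau)) * expR (- (x * y)) * expR (x * z).
  by rewrite -!expRD; congr expR; ring.
by rewrite /fbm_weight !expE; ring.
Qed.

(** The coefficient c serves both kernels: 0 for [osc_h], 1/2 for [osc_h_tilde]. The squared times
    sum to 2 (t - s) (v - u) over the differences and to the opposite over the sums, so the
    quadratic part cancels too. *)
Lemma has_sum_int_sub_fbm (h : R -> R) (c r H u v s t tau : R) :
  (forall x, 0 <= x -> has_sum_int (fun j : int => (b * a ^ j) `^ (- r) *
     (expR (- (b * a ^ j * x)) - 1 + b * a ^ j * x - c * (b * a ^ j * x) ^+ 2))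
     (x `^ (2 * H) * h x)) ->
  0 <= u -> u <= v -> v <= s -> s <= t -> 0 <= tau ->
  has_sum_int (fun j : int => (b * a ^ j) `^ (- r) *
    (expR (- (b * a ^ j * tau)) * sub_fbm_weight u v s t (b * a ^ j)))
    (rect_incr (sub_fbm_cov h H) u v (s + tau) (t + tau)).
Proof.
move=> S u0 uv vs st tau0; rewrite sub_fbm_rect_incrE; [|lra..].
have := has_sum_intZ 2^-1 (has_sum_intD (has_sum_intD
  (has_sum_intB (S (s + tau - v) _) (S (t + tau - v) _))
  (has_sum_intB (S (t + tau - u) _) (S (s + tau - u) _)))
  (has_sum_intD
  (has_sum_intB (S (v + (s + tau)) _) (S (v + (t + tau)) _))
  (has_sum_intB (S (u + (t + tau)) _) (S (u + (s + tau)) _)))).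
move=> /(_ ltac:(lra) ltac:(lra) ltac:(lra) ltac:(lra)
  ltac:(lra) ltac:(lra) ltac:(lra) ltac:(lra)).
congr has_sum_int; apply/funext => j; set x := b * a ^ j.
have expBE y z : expR (- (x * (y + tau - z))) =
    expR (- (x * tau)) * expR (- (x * y)) * expR (x * z).
  by rewrite -!expRD; congr expR; ring.
have expDE y z : expR (- (x * (z + (y + tau)))) =
    expR (- (x * tau)) * expR (- (x * y)) * expR (- (x * z)).
  by rewrite -!expRD; congr expR; ring.
have expuv : expR (- (x * (u + v))) = expR (- (x * u)) * expR (- (x * v)).
  by rewrite -expRD; congr expR; ring.
have := expRxMexpNx_1 (x * u); have := expRxMexpNx_1 (x * v).
rewrite /sub_fbm_weight /fbm_weight !expBE !expDE expuv.
move: (expR (x * u)) (expR (x * v)) (expR (- (x * u))) (expR (- (x * v))).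
move: (expR (- (x * tau))) (expR (- (x * s))) (expR (- (x * t))).
move: (x `^ (- r)) => k e es et eu ev eu' ev' hv hu.
(* Regrouped so that exp(xv) exp(-xv) and exp(xu) exp(-xu) appear, both equal to 1 by [hv] and
   [hu]. *)
have -> : 2^-1 * ((es - et) * (ev - eu)) * (1 - eu' * ev') =
    2^-1 * (es - et) * (ev - eu - (ev * ev') * eu' + (eu * eu') * ev') by ring.
by rewrite hu hv; field.
Qed.

End Covariances.

(** * Power bounds for the weights *)

Section WeightBounds.
Variable R : realType.
Implicit Types u v s t x : R.

(** [expRB_bounds] applies to each factor. Below, exp(xu) >= 1; above, exp(-xs) exp(xv) <= 1 because
    v <= s. *)
Lemma fbm_weight_bounds u v s t x :
  0 <= u -> u < v -> v <= s -> s < t -> 0 < x ->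
  (t - s) * (v - u) / 2 * x ^+ 2 * expR (- (x * t)) <=
    fbm_weight u v s t x <= (t - s) * (v - u) / 2 * x ^+ 2.
Proof.
move=> u0 uv vs st x0; set M := (t - s) * (v - u) / 2.
have /andP[l1 r1] := expRB_bounds (- (x * s)) (- (x * t)).
have /andP[l2 r2] := expRB_bounds (x * v) (x * u).
rewrite (_ : - (x * s) - - (x * t) = x * (t - s)) in l1 r1; last by ring.
rewrite -mulrBr in l2 r2.
have ts0 : 0 <= x * (t - s) by rewrite mulr_ge0; lra.
have vu0 : 0 <= x * (v - u) by rewrite mulr_ge0; lra.
rewrite /fbm_weight; apply/andP; split.
- have -> : M * x ^+ 2 * expR (- (x * t)) =
      2^-1 * (x * (t - s) * expR (- (x * t)) * (x * (v - u))).
    by rewrite /M; field.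
  rewrite ler_wpM2l ?invr_ge0//.
  apply: ler_pM => //; first by apply: mulr_ge0 => //; exact: expR_ge0.
  apply: le_trans l2; rewrite ler_peMr// -[leLHS]expR0 ler_expR.
  by rewrite mulr_ge0// ltW.
- have -> : M * x ^+ 2 = 2^-1 * (x * (t - s) * (x * (v - u)) * 1).
    by rewrite /M; field.
  rewrite ler_wpM2l ?invr_ge0//.
  apply: (@le_trans _ _ (x * (t - s) * expR (- (x * s)) *
    (x * (v - u) * expR (x * v)))).
    apply: ler_pM => //.
    + by apply: le_trans l1; rewrite mulr_ge0// expR_ge0.
    + by apply: le_trans l2; rewrite mulr_ge0// expR_ge0.
  rewrite mulrACA; apply: ler_wpM2l; first exact: mulr_ge0.
  rewrite -expRD expR_le1 addrC subr_le0.
  by rewrite ler_wpM2l ?(ltW x0).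
Qed.

(** The extra factor lies between x (u + v) exp(-x (u + v)) and x (u + v): one more power of x, and
    t + (u + v) in the exponent. *)
Lemma sub_fbm_weight_bounds u v s t x :
  0 <= u -> u < v -> v <= s -> s < t -> 0 < x ->
  (t - s) * (v - u) / 2 * (u + v) * x ^+ 3 * expR (- (x * (t + (u + v)))) <=
    sub_fbm_weight u v s t x <= (t - s) * (v - u) / 2 * (u + v) * x ^+ 3.
Proof.
move=> u0 uv vs st x0; set M := (t - s) * (v - u) / 2 * (u + v).
have /andP[l1 r1] := fbm_weight_bounds u0 uv vs st x0.
have /andP[l2 r2] := expRB_bounds 0 (- (x * (u + v))).
rewrite expR0 sub0r opprK mulr1 in l2 r2.
have ts0 : 0 <= (t - s) * (v - u) / 2 by rewrite divr_ge0// mulr_ge0; lra.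
have uv0 : 0 <= x * (u + v) by rewrite mulr_ge0; lra.
have lp : 0 <= (t - s) * (v - u) / 2 * x ^+ 2 * expR (- (x * t)).
  by rewrite mulr_ge0 ?expR_ge0// mulr_ge0// sqr_ge0.
have lq : 0 <= x * (u + v) * expR (- (x * (u + v))).
  by rewrite mulr_ge0// expR_ge0.
rewrite /sub_fbm_weight; apply/andP; split.
- have -> : M * x ^+ 3 * expR (- (x * (t + (u + v)))) =
      (t - s) * (v - u) / 2 * x ^+ 2 * expR (- (x * t)) *
      (x * (u + v) * expR (- (x * (u + v)))).
    by rewrite mulrDr opprD expRD /M; ring.
  exact: ler_pM.
- have -> : M * x ^+ 3 = (t - s) * (v - u) / 2 * x ^+ 2 * (x * (u + v)).
    by rewrite /M; ring.
  by apply: ler_pM => //; [exact: le_trans l1 | exact: le_trans l2].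
Qed.

End WeightBounds.

(** * Lower and upper limits of an eventually bounded function *)

Lemma limf_bounds (R : realType) (T : choiceType) (X : filteredType T)
    (F : set_system X)
    (FF : ProperFilter F) (f : X -> \bar R) (c1 c2 : \bar R) :
  (\forall x \near F, c1 <= f x <= c2)%E ->
  [/\ (c1 <= limf_einf f F)%E, (limf_einf f F <= limf_esup f F)%E &
      (limf_esup f F <= c2)%E].
Proof.
pose A : set X := [set x | (c1 <= f x <= c2)%E].
move=> Fc; have {}Fc : F A := Fc.
rewrite limf_einfE limf_esupE; split.
- apply: le_ereal_sup_tmp; exists (ereal_inf (f @` A)); first exact: imageP.
  by apply: le_ereal_inf_tmp => _ [x /andP[? _] <-].
(* The filter is proper, so B and C share a point x, and f x separates the infimum over B from the
   supremum over C. *)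
- apply: ge_ereal_sup => _ [B FB <-]; apply: le_ereal_inf_tmp => _ [C FC <-].
  have [x [Bx Cx]] := filter_ex (filterI FB FC).
  apply: (@le_trans _ _ (f x)).
    by apply: ereal_inf_lbound; exists x.
  by apply: ereal_sup_ubound; exists x.
- apply: ge_ereal_inf; exists (ereal_sup (f @` A)); first exact: imageP.
  by apply: ge_ereal_sup => _ [x /andP[_ ?] <-].
Qed.

(** * Expectations of products of increments *)

Section IncrementCovariance.
Context (R : realType) (d : measure_display) (T : measurableType d)
  (P : probability T R).

(* The expectation is a difference of two integrals in the extended reals, which
   is finite only if both are. *)
Lemma Lfun1_of_expectation (X : T -> R) (c : R) :
  measurable_fun setT X -> ('E_P[X] = c%:E)%E -> X \in Lfun P 1.
Proof.
move=> mX; rewrite unlock => EX; apply/Lfun1_integrable/integrableP; split.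
  exact/measurable_EFinP.
by rewrite integral_fin_num_abs// EX.
Qed.

(** Each product of two values has a finite expectation, hence is integrable, and the expanded
    expectation splits by linearity. *)
Lemma shifted_increment_covE (X : R -> {RV P >-> R}) (K : R -> R -> R)
    (u v s t tau : R) :
  centered_gaussian_process X K ->
  0 <= u -> 0 <= v -> 0 <= s + tau -> 0 <= t + tau ->
  shifted_increment_cov X u v s t tau =
    (rect_incr K u v (s + tau) (t + tau))%:E.
Proof.
move=> [_ _ covX] u0 v0 s0 t0.
pose Y (p q : R) : T -> R := (X p : T -> R) \* (X q : T -> R).
have EY p q : 0 <= p -> 0 <= q -> ('E_P[Y p q] = (K p q)%:E)%E by exact: covX.
have LY p q : 0 <= p -> 0 <= q -> Y p q \in Lfun P 1.
  move=> p0 q0; apply: Lfun1_of_expectation (EY p q p0 q0).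
  exact: measurable_funM.
rewrite /shifted_increment_cov.
have -> : (((X v : T -> R) \- (X u : T -> R)) *
         ((X (t + tau) : T -> R) \- (X (s + tau) : T -> R)))%R =
  (Y v (t + tau) \- Y v (s + tau)) \- (Y u (t + tau) \- Y u (s + tau)).
  apply/funext => w; rewrite /Y /=.
  suff h (x y z r : R) : (x - y) * (z - r) = x * z - x * r - (y * z - y * r).
    exact: h.
  by ring.
by rewrite !expectationB ?EY//= ?rpredB//= ?LY.
Qed.

End IncrementCovariance.

(** * Power-law decay of the increment covariances *)

Theorem proposition2p20 (R : realType) (a b u v s t : R)
    (a_gt0 : 0 < a) (a_lt1 : a < 1) (b_gt0 : 0 < b)
    (u_ge0 : 0 <= u) (uv : u < v) (vs : v <= s) (st : s < t) :
  (forall H : R, 1 / 2 < H < 1 ->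
    exists C1 C2 : R, 0 < C1 /\ 0 < C2 /\
    forall (d : measure_display) (T : measurableType d) (P : probability T R)
      (xi : R -> {RV P >-> R}), osc_fbm a b H xi ->
      let f := fun tau : R =>
        ((tau `^ (2 - 2 * H))%:E * shifted_increment_cov xi u v s t tau)%E in
      [/\ (C1%:E <= limf_einf f (pinfty_nbhs R))%E,
          (limf_einf f (pinfty_nbhs R) <= limf_esup f (pinfty_nbhs R))%E &
          (limf_esup f (pinfty_nbhs R) <= C2%:E)%E]) /\
  (forall H : R, 1 / 2 < H < 1 \/ 1 < H < 3 / 2 ->
    exists C3 C4 : R, 0 < C3 /\ 0 < C4 /\
    forall (d : measure_display) (T : measurableType d) (P : probability T R)
      (zeta : R -> {RV P >-> R}),
      osc_sub_fbm a b H zeta \/ osc_neg_sub_fbm a b H zeta ->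
      let f := fun tau : R =>
        ((tau `^ (3 - 2 * H))%:E * shifted_increment_cov zeta u v s t tau)%E in
      [/\ (C3%:E <= limf_einf f (pinfty_nbhs R))%E,
          (limf_einf f (pinfty_nbhs R) <= limf_esup f (pinfty_nbhs R))%E &
          (limf_esup f (pinfty_nbhs R) <= C4%:E)%E]).
Proof.
have C2_gt0 (M p : R) : 0 < M -> 0 < p -> 0 < M * (64 / (1 - a `^ p)).
  move=> M0 p0; rewrite mulr_gt0// divr_gt0// subr_gt0 powR_lt1//.
  by rewrite a_lt1 ltW.
have M1_gt0 : 0 < (t - s) * (v - u) / 2.
  by rewrite divr_gt0// mulr_gt0// subr_gt0.
have M2_gt0 : 0 < (t - s) * (v - u) / 2 * (u + v) by rewrite mulr_gt0//; lra.
split => H HH.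
(* The constants of [has_sum_int_laplace_bounds] for k = 2 and r = 2H; they are independent of the
   process. *)
- exists ((t - s) * (v - u) / 2 * expR (- (a^-1 + 1))),
    ((t - s) * (v - u) / 2 * (64 / (1 - a `^ (2 - 2 * H)))).
  split; first by rewrite mulr_gt0 ?expR_gt0.
  split; first by apply: C2_gt0 => //; lra.
  move=> d T P X [_ covX] f; apply: limf_bounds; near=> tau.
  have tau0 : 0 <= tau by near: tau; apply: nbhs_pinfty_ge; rewrite num_real.
  rewrite /f (shifted_increment_covE covX); [|lra..].
  rewrite -EFinM !lee_fin.
  apply: (@has_sum_int_laplace_bounds _ a b a_gt0 a_lt1 b_gt0 (2 * H) 2
    (fbm_weight u v s t) _ t).
  + lra.
  + lra.
  + exact: ltW.
  + by move=> x x0; exact: fbm_weight_bounds.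
  + by near: tau; apply: nbhs_pinfty_ge; rewrite num_real.
  + by near: tau; apply: nbhs_pinfty_ge; rewrite num_real.
  + by apply: has_sum_int_fbm => //; exact: ltW.
- exists ((t - s) * (v - u) / 2 * (u + v) * expR (- (a^-1 + 1))),
    ((t - s) * (v - u) / 2 * (u + v) * (64 / (1 - a `^ (3 - 2 * H)))).
  split; first by rewrite mulr_gt0 ?expR_gt0.
  split; first by apply: C2_gt0 => //; case: HH; lra.
  move=> d T P X hX f; apply: limf_bounds; near=> tau.
  have tau0 : 0 <= tau by near: tau; apply: nbhs_pinfty_ge; rewrite num_real.
  (* Shared by both ranges of H: the weight is the same, and p = 3 - 2H lies in (0, 2) either
     way. *)
  have core S :
      has_sum_int (fun j : int => (b * a ^ j) `^ (- (2 * H)) *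
        (expR (- (b * a ^ j * tau)) * sub_fbm_weight u v s t (b * a ^ j))) S ->
      (t - s) * (v - u) / 2 * (u + v) * expR (- (a^-1 + 1)) <=
      tau `^ (3 - 2 * H) * S <=
      (t - s) * (v - u) / 2 * (u + v) * (64 / (1 - a `^ (3 - 2 * H))).
    apply: (@has_sum_int_laplace_bounds _ a b a_gt0 a_lt1 b_gt0 (2 * H) 3
      (sub_fbm_weight u v s t) _ (t + (u + v))).
    + case: HH; lra.
    + lra.
    + exact: ltW.
    + by move=> x x0; exact: sub_fbm_weight_bounds.
    + by near: tau; apply: nbhs_pinfty_ge; rewrite num_real.
    + by near: tau; apply: nbhs_pinfty_ge; rewrite num_real.
  case: hX => -[H01 covX];
    (rewrite /f (shifted_increment_covE covX); [|lra..]);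
    rewrite -EFinM !lee_fin; apply: core.
  + apply: (@has_sum_int_sub_fbm _ a b _ 0) => //; try exact: ltW.
    move=> x x0; have := has_sum_int_osc_h a_gt0 a_lt1 b_gt0 H01 x0.
    by congr has_sum_int; apply/funext => j; rewrite mul0r subr0.
  + apply: (@has_sum_int_sub_fbm _ a b _ 2^-1) => //; try exact: ltW.
    move=> x x0; have := has_sum_int_osc_h_tilde a_gt0 a_lt1 b_gt0 H01 x0.
    by congr has_sum_int; apply/funext => j; rewrite [_ / 2]mulrC.
Unshelve. all: by end_near. Qed.
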